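(* Let $k\ge1$ be a fixed integer. For $\omega\in\mathfrak{B}_n$ chosen uniformly at random, with $\beta=\beta(\omega)$, as $n\to\infty$, $$\mathbb{E}\left[\left(\frac{\beta}{n^3}\right)^k\right]=\frac{6}{2^k}\int_{0\le x<y<z\le1}(y-x)^k(z-x)^k(z-y)^k\,dV+O\left(\frac{k}{2^kn}\right).$$
   Context: $\mathfrak{S}_n$ is the set of permutations of $[n]=\{1,\dots,n\}$, in one-line notation. A reduction of $\omega\in\mathfrak{S}_n$ interchanges $\omega(i)$ and $\omega(j)$ for some $i<j$ with $\omega(i)>\omega(j)$. Bruhat order: $\pi\le\sigma$ if $\pi$ is obtained from $\sigma$ by a (possibly empty) sequence of reductions. $\mathfrak{B}_n\subseteq\mathfrak{S}_n$ is the set of bigrassmannian permutations, i.e. those $\omega$ such that both $\omega$ and $\omega^{-1}$ have exactly one descent; equivalently $\omega=1\cdots a\,(b+1)\cdots c\,(a+1)\cdots b\,(c+1)\cdots n$ for some $0\le a<b<c\le n$. For $\omega\in\mathfrak{B}_n$, $\beta(\omega)$ is the number of $\pi\in\mathfrak{B}_n$ with $\pi\le\omega$. The integral is over the region $\{(x,y,z)\in\mathbb{R}^3:0\le x<y<z\le 1\}$ with respect to Lebesgue measure. The $O$-notation is for $n\to\infty$ with $k$ fixed. *)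

(* Defs.v *)
From mathcomp Require Import all_boot all_order all_algebra all_fingroup.
From mathcomp Require Import all_classical all_reals all_analysis.

Set Implicit Arguments.
Unset Strict Implicit.
Unset Printing Implicit Defensive.

Import Order.TTheory GRing.Theory Num.Theory.

Local Open Scope ring_scope.

(* [n] is represented by 'I_n = {0, ..., n-1}; all notions below depend only on
   the relative order of positions and values. *)

(* Permutations compose left to right, so (tperm i j * s)%g is the function
   x |-> s (tperm i j x): the values of s at positions i and j are swapped. *)
Definition reduction (n : nat) (s p : 'S_n) : bool :=
  [exists i : 'I_n, exists j : 'I_n,
    [&& (i < j)%N, (s j < s i)%N & p == (tperm i j * s)%g]].

(* p <= s in Bruhat order: p is reachable from s by reductions. *)
Definition bruhat_le (n : nat) (p s : 'S_n) : bool :=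
  connect (@reduction n) s p.

Definition descents (n : nat) (s : 'S_n) : {set 'I_n} :=
  [set i : 'I_n | [exists j : 'I_n,
    (nat_of_ord j == i.+1) && (s j < s i)%N]].

Definition bigrassmannian (n : nat) : {set 'S_n} :=
  [set s : 'S_n | (#|descents s| == 1%N) && (#|descents (s^-1)%g| == 1%N)].

Definition beta (n : nat) (s : 'S_n) : nat :=
  #|[set p in bigrassmannian n | bruhat_le p s]|.

(* Expectation of f under the uniform distribution on A; the value is 0 when A
   is empty (for A = bigrassmannian n, this only happens for n <= 1). *)
Definition uniform_expectation (R : realType) (T : finType) (A : {set T})
    (f : T -> R) : R :=
  (\sum_(t in A) f t) / #|A|%:R.

(* Points of R^3 are encoded as ((x, y), z) : R * R * R. *)
Definition ordered_triples (R : realType) : set (R * R * R) :=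
  [set v | [/\ 0 <= v.1.1, v.1.1 < v.1.2, v.1.2 < v.2 & v.2 <= 1]]%classic.

(* Main.v *)
Require Import Defs.
From mathcomp Require Import all_boot all_order all_algebra all_fingroup.
From mathcomp Require Import all_classical all_reals all_analysis.
From mathcomp Require Import measurable_realfun.
From mathcomp Require Import zify ring lra.

Set Implicit Arguments.
Unset Strict Implicit.
Unset Printing Implicit Defensive.

Import Order.TTheory GRing.Theory Num.Theory.
Import numFieldNormedType.Exports.

(* Let rk w i j count the first i positions at which w takes a value >= j.
   Reductions decrease rk pointwise, and the bigrassmannian permutation with
   parameters (a, b, c) is the least permutation whose rank at (a + c - b, b) is
   at least c - b. Hence the bigrassmannian permutations below w correspond to
   the triples (i, j, r) with max(0, i - j) < r <= rk w i j, and summing over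
   them gives 2 beta(w) = sum_x (w x - x)^2. For w given by (a, b, c) this is
   (b - a)(c - b)(c - a), so the k-th moment is exactly
   2^-k / binom(n + 1, 3) times the sum of f^k over the grid {0, 1/n, ..., 1}^3,
   where f is the product of the positive parts of y - x, z - x, z - y. As f is
   Lipschitz, this is a Riemann sum with error O(k / n) on the unit cube cut
   into (n + 1)^3 cells. *)

(** * Bigrassmannian permutations and the Bruhat order *)

Notation triple n := ('I_n.+1 * 'I_n.+1 * 'I_n.+1)%type.

Section bigrassmannian.
Local Open Scope nat_scope.

(* One-line notation 1..a (b+1)..c (a+1)..b (c+1)..n, with positions and values
   shifted to start from 0. *)
Definition block_swap (a b c x : nat) : nat :=
  if x < a then x else if x < a + (c - b) then x + (b - a)
  else if x < c then x - (c - b) else x.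

Ltac block_swap_lia := rewrite /block_swap; repeat case: ifP; lia.

Lemma block_swap_lt a b c n x : a <= b <= c -> c <= n -> x < n ->
  block_swap a b c x < n.
Proof. by block_swap_lia. Qed.

(** The blocks of lengths [c - b] and [b - a] are swapped back by the same map with the two lengths
    exchanged, so the cut moves from [b] to [a + (c - b)]. *)
Lemma block_swapK a b c x : a <= b <= c ->
  block_swap a (a + (c - b)) c (block_swap a b c x) = x.
Proof. by block_swap_lia. Qed.

(* The default value 1 is only taken when a <= b <= c <= n fails. *)
Definition omega n (a b c : nat) : 'S_n :=
  insubd (1%g : 'S_n) [ffun x : 'I_n => insubd x (block_swap a b c x)].

Lemma omegaE n a b c (x : 'I_n) : a <= b <= c -> c <= n ->
  omega n a b c x = block_swap a b c x :> nat.
Proof.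
move=> abc cn; rewrite -pvalE.
have vE (y : 'I_n) :
    (insubd y (block_swap a b c y) : 'I_n) = block_swap a b c y :> nat.
  by rewrite val_insubd (block_swap_lt abc cn).
rewrite [pval _]val_insubd.
suff -> : injectiveb [ffun x : 'I_n => insubd x (block_swap a b c x)].
  by rewrite ffunE vE.
apply/injectiveP => y z; rewrite !ffunE => /(congr1 val) /=.
rewrite !vE => e; apply: val_inj => /=.
by rewrite -(block_swapK y abc) e block_swapK.
Qed.

Lemma omegaV n a b c : a <= b <= c -> c <= n ->
  ((omega n a b c)^-1)%g = omega n a (a + (c - b)) c.
Proof.
move=> abc cn; apply/permP => x; apply: (perm_inj (s := omega n a b c)).
rewrite permKV; apply: val_inj; rewrite /= !omegaE //; last by lia.
block_swap_lia.
Qed.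

(** * Rank function, reductions and the Bruhat order *)

Definition rk n (s : 'S_n) (i j : nat) : nat :=
  \sum_(x < n) ((x < i) && (j <= s x)).

(** Cardinalities are handled as sums of booleans, so that comparing two of them reduces to a
    termwise check; this lemma evaluates the intervals. *)
Lemma sum_interval n l m : \sum_(y < n) (l <= y < m) = minn m n - l.
Proof. by elim: n => [|n IH]; rewrite ?big_ord0 ?big_ord_recr /= ?IH; lia. Qed.

(** Only the terms at [x] and [y] change. It serves both for the rank and for the termination
    measure in [omega_le]. *)
Lemma sum_tperm n (G : 'I_n -> 'I_n -> nat) (s : 'S_n) x y : x != y ->
  \sum_z G z ((tperm x y * s)%g z) + (G x (s x) + G y (s y)) =
  \sum_z G z (s z) + (G x (s y) + G y (s x)).
Proof.
move=> xy; rewrite (bigD1 x) // (bigD1 y) 1?eq_sym //=.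
rewrite [in RHS](bigD1 x) // [in RHS](bigD1 y) 1?eq_sym //=.
rewrite !permM tpermL tpermR.
rewrite (eq_bigr (fun z => G z (s z))); first by lia.
by move=> z /andP[zx zy]; rewrite permM tpermD // eq_sym.
Qed.

(** The rank drops by one exactly on the rectangle spanned by the inversion. *)
Lemma rk_tperm n (s : 'S_n) (x y : 'I_n) i j : x < y -> s y < s x ->
  rk (tperm x y * s)%g i j + ((x < i <= y) && (s y < j <= s x)) = rk s i j.
Proof.
move=> xy syx; have xNy : x != y by rewrite -val_eqE /=; lia.
have := sum_tperm (fun z v : 'I_n => (z < i) && (j <= v) : nat) s xNy.
rewrite /rk /=; by move: (\sum_(z < n) _) (\sum_(z < n) _) => A B; lia.
Qed.

Lemma bruhat_rk n (p s : 'S_n) i j : bruhat_le p s -> rk p i j <= rk s i j.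
Proof.
case/connectP => l; elim: l s => [|t l IH] s /=; first by move=> _ ->.
case/andP => /existsP[x] /existsP[y] /and3P[xy syx /eqP tE] pl pe.
have := rk_tperm i j xy syx; rewrite -tE.
have := IH _ pl pe; lia.
Qed.

Lemma sum_perm_lt n (w : 'S_n) m : \sum_y (w y < m) = minn m n.
Proof.
rewrite -[RHS]subn0 -sum_interval [RHS](reindex_inj (@perm_inj _ w)) /=.
by apply: eq_bigr => y _; lia.
Qed.

(* Both sides count the y such that y < x or w y < w x. *)
Lemma perm_displacement n (w : 'S_n) (x : 'I_n) :
  w x + \sum_(y < n) ((y < x) && (w x < w y)) =
  x + \sum_(y < n) ((x < y) && (w y < w x)).
Proof.
have wxE : nat_of_ord (w x) = \sum_(y < n) (w y < w x).
  by rewrite sum_perm_lt; have := ltn_ord (w x); lia.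
have xE : nat_of_ord x = \sum_(y < n) (0 <= y < x).
  by rewrite sum_interval; have := ltn_ord x; lia.
rewrite {1}wxE [X in _ = X + _]xE.
rewrite -!big_split /=; apply: eq_bigr => y _.
have [->|yx] := eqVneq y x; first by lia.
have : w y != w x by rewrite (inj_eq perm_inj).
by move: yx; rewrite -!val_eqE /=; lia.
Qed.

(** The rectangle of every inversion contains [(i, j)]. Equivalently, [w] increases on the positions
    before [i] and on those from [i] on, and its inverse does so with respect to [j]. *)
Definition inversions_across n (w : 'S_n) (i j : nat) : Prop :=
  forall x y : 'I_n, x < y -> w y < w x -> (x < i <= y) && (w y < j <= w x).

(** Positions fall into four classes according to [x < i] and [w x < j]. Monotonicity makes each
    class an interval, and [perm_displacement] gives the constant shift [w x - x] on it: [0], [p],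
    [-r] and [0]. *)
Lemma across_omega n (w : 'S_n) i j : i <= n -> j <= n ->
  inversions_across w i j ->
  [/\ rk w i j <= i, i <= j + rk w i j, j + rk w i j <= n &
      w = omega n (i - rk w i j) j (j + rk w i j)].
Proof.
move=> ile jle acr; set r := rk w i j.
set p := \sum_(x < n) ((i <= x) && (w x < j)).
set a := \sum_(x < n) ((x < i) && (w x < j)).
have ar : a + r = i.
  rewrite -[RHS](_ : minn i n - 0 = i); last by lia.
  by rewrite -sum_interval -big_split; apply: eq_bigr => x _ /=; lia.
have ap : a + p = j.
  rewrite -[RHS](_ : minn j n = j); last by lia.
  rewrite -(sum_perm_lt w) -big_split; apply: eq_bigr => x _ /=; lia.
have pr : p + r <= n - a.
  suff : \sum_(x < n) ((i <= x) && (w x < j)) +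
    \sum_(x < n) ((x < i) && (j <= w x)) +
    \sum_(x < n) ((x < i) && (w x < j)) <= \sum_(x < n) (0 <= x < n).
    by rewrite sum_interval -/p -/a -/(rk w i j) -/r; lia.
  by rewrite -!big_split; apply: leq_sum => x _ /=; have := ltn_ord x; lia.
split; [lia|lia|lia|apply/permP => x; apply: val_inj].
rewrite /= omegaE; [|lia|lia].
(* No inversion has both positions on the same side of [i]. *)
have mono (y : 'I_n) : y < x -> (x < i) || (i <= y) -> w y < w x.
  move=> yx h; have yNx : y != x by rewrite -val_eqE /=; lia.
  have : w y != w x by rewrite (inj_eq perm_inj).
  by rewrite -val_eqE /=; have := acr y x yx; lia.
have mono' (y : 'I_n) : x < y -> (y < i) || (i <= x) -> w x < w y.
  move=> yx h; have yNx : y != x by rewrite -val_eqE /=; lia.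
  have : w y != w x by rewrite (inj_eq perm_inj).
  by rewrite -val_eqE /=; have := acr x y yx; lia.
have xn := ltn_ord x.
have disp := perm_displacement w x.
have [xi|ix] := ltnP x i; have [wj|jw] := ltnP (w x) j.
- have xa : \sum_(y < n) (0 <= y < x.+1) <= a.
    apply: leq_sum => y _; have [->|yx] := eqVneq y x; first by lia.
    by have := mono y; move: yx; rewrite -val_eqE /=; lia.
  rewrite sum_interval in xa.
  move: disp; rewrite !big1 => [|y _|y _]; first by block_swap_lia.
    by have := acr x y; lia.
  by have := acr y x; lia.
- have xa : a <= \sum_(y < n) (0 <= y < x).
    apply: leq_sum => y _; have [->|yx] := eqVneq y x; first by lia.
    by have := mono' y; move: yx; rewrite -val_eqE /=; lia.
  rewrite sum_interval in xa.
  move: disp; rewrite big1 => [|y _]; last by have := acr y x; lia.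
  suff -> : \sum_(y < n) ((x < y) && (w y < w x)) = p.
    by block_swap_lia.
  by apply: eq_bigr => y _; have := acr x y; lia.
- have xa : \sum_(y < n) (i <= y < x.+1) <= p.
    apply: leq_sum => y _; have [->|yx] := eqVneq y x; first by lia.
    by have := mono y; move: yx; rewrite -val_eqE /=; lia.
  rewrite sum_interval in xa.
  move: disp.
  rewrite [X in _ = _ + X]big1 => [|y _]; last by have := acr x y; lia.
  suff -> : \sum_(y < n) ((y < x) && (w x < w y)) = r.
    by block_swap_lia.
  by apply: eq_bigr => y _; have := acr y x; lia.
- have xa : p <= \sum_(y < n) (i <= y < x).
    apply: leq_sum => y _; have [->|yx] := eqVneq y x; first by lia.
    by have := mono' y; move: yx; rewrite -val_eqE /=; lia.
  rewrite sum_interval in xa.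
  move: disp; rewrite !big1 => [|y _|y _]; first by block_swap_lia.
    by have := acr x y; lia.
  by have := acr y x; lia.
Qed.

(* For the converse direction, apply reductions to w as long as the rank at
   (a + (c - b), b) stays at least c - b. When none is left, every inversion
   goes across that point and the rank equals c - b, which forces w = omega. *)
Lemma omega_le n (w : 'S_n) a b c : a < b < c -> c <= n ->
  bruhat_le (omega n a b c) w = (c - b <= rk w (a + (c - b)) b).
Proof.
move=> abc cn; apply/idP/idP.
  move/(bruhat_rk (a + (c - b)) b); apply: leq_trans.
  apply: (@leq_trans (\sum_(y < n) (a <= y < a + (c - b)))).
    by rewrite sum_interval; lia.
  apply: leq_sum => y _; rewrite omegaE; [|lia|lia].
  block_swap_lia.
(* By the rearrangement inequality each reduction strictly increases [M], which is bounded; the gap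
   to the bound is the induction measure. *)
pose M (s : 'S_n) := \sum_(z < n) z * s z.
have Mle s : M s <= n * (n * n).
  rewrite -[leqRHS]/(_ * _) -{1}(card_ord n) -sum_nat_const.
  apply: leq_sum => z _.
  by apply: leq_mul; apply: ltnW.
have [m] := ubnP (n * (n * n) - M w); elim: m w => // m IH w wm rw.
case: (boolP [exists x : 'I_n, exists y : 'I_n, [&& x < y, w y < w x &
    c - b <= rk (tperm x y * w)%g (a + (c - b)) b]]).
  case/existsP => x /existsP[y] /and3P[xy wyx rw'].
  apply: (@connect_trans _ _ (tperm x y * w)%g); last first.
    apply: IH => //; have xNy : x != y by rewrite -val_eqE /=; lia.
    have := sum_tperm (fun z v : 'I_n => z * v) w xNy; rewrite -!/(M _).
    have : x * w x + y * w y < x * w y + y * w x.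
      rewrite -(subnKC xy) -(subnKC wyx).
      move: (y - x.+1) (w x - (w y).+1) => d e.
      by lia.
    have := Mle (tperm x y * w)%g; move: wm.
    move: (M w) (M (_ * _)%g) (n * (n * n)); move: (x * w x) (y * w y) (x * w y) (y * w x).
    lia.
  by apply: connect1; apply/existsP; exists x; apply/existsP; exists y;
    rewrite xy wyx /=.
rewrite negb_exists => /forallP H.
have {}H (x y : 'I_n) : x < y -> w y < w x ->
    rk (tperm x y * w)%g (a + (c - b)) b < c - b.
  move=> xy wyx; have := H x; rewrite negb_exists => /forallP/(_ y).
  by rewrite xy wyx /= ltnNge.
have acr : inversions_across w (a + (c - b)) b.
  move=> x y xy wyx; have := rk_tperm (a + (c - b)) b xy wyx.
  by have := H _ _ xy wyx; lia.
have ile : a + (c - b) <= n by lia.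
have jle : b <= n by lia.
have [h1 h2 h3 wE] := across_omega ile jle acr.
suff e : rk w (a + (c - b)) b = c - b.
  have -> : omega n a b c = w; last by exact: connect0.
  by rewrite [RHS]wE e; congr omega; lia.
(* The two positions around the cut form an inversion. Undoing it lowers the rank by at most one,
   yet below [c - b], so the rank was exactly [c - b]. *)
have xn : (a + (c - b)).-1 < n by lia.
have yn : a + (c - b) < n by lia.
pose x := Ordinal xn; pose y := Ordinal yn.
have xy : x < y by rewrite /=; lia.
have wyx : w y < w x.
  by rewrite wE !omegaE; [rewrite /=; block_swap_lia|lia..].
have := rk_tperm (a + (c - b)) b xy wyx.
by have := H _ _ xy wyx; lia.
Qed.

(** * Descents and the parametrisation of bigrassmannian permutations *)

Lemma mem_descents n (w : 'S_n) (k : 'I_n) :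
  reflect (exists2 l : 'I_n, l = k.+1 :> nat & w l < w k) (k \in descents w).
Proof.
rewrite inE; apply: (iffP existsP) => -[l].
  by case/andP => /eqP; exists l.
by move=> lk wlk; exists l; rewrite lk eqxx.
Qed.

(** If [x] is not a descent, then [x.+1] and [y] still form an inversion, at a smaller distance. *)
Lemma inversion_descent n (w : 'S_n) (x y : 'I_n) : x < y -> w y < w x ->
  exists2 k, k \in descents w & x <= k < y.
Proof.
have [m] := ubnP (y - x); elim: m x => // m IH x mxy xy wyx.
have x1n : x.+1 < n by have := ltn_ord y; lia.
pose z := Ordinal x1n; case: (ltnP (w z) (w x)) => wzx.
  by exists x; [apply/mem_descents; exists z|lia].
have zy : z < y.
  suff : z != y by rewrite -val_eqE /=; lia.
  by apply: contraTneq wyx => <-; lia.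
have [|//||k kd kzy] := IH z; [by rewrite /=; lia|lia|].
by exists k => //; move: kzy; rewrite /=; lia.
Qed.

Lemma descents_omega n a b c (k : 'I_n) : a < b < c -> c <= n ->
  (k \in descents (omega n a b c)) = (k == (a + (c - b)).-1 :> nat).
Proof.
move=> abc cn; have kn := ltn_ord k.
apply/mem_descents/eqP => [[l lk]|kE].
  by rewrite !omegaE; [rewrite lk; block_swap_lia|lia..].
have ln : a + (c - b) < n by lia.
exists (Ordinal ln); first by rewrite /=; lia.
by rewrite !omegaE; [rewrite /=; block_swap_lia|lia..].
Qed.

Lemma card_descents_omega n a b c : a < b < c -> c <= n ->
  #|descents (omega n a b c)| = 1.
Proof.
move=> abc cn; have kn : (a + (c - b)).-1 < n by lia.
suff -> : descents (omega n a b c) = [set Ordinal kn] by rewrite cards1.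
by apply/setP => k; rewrite descents_omega // finset.in_set1 -val_eqE.
Qed.

Lemma omega_bigrassmannian n a b c : a < b < c -> c <= n ->
  omega n a b c \in bigrassmannian n.
Proof.
move=> abc cn; rewrite inE omegaV; [|lia|lia].
by rewrite !card_descents_omega //; lia.
Qed.

(** Every inversion of [w] straddles its only descent [d], and by values the only descent [e] of the
    inverse. All inversions thus go across [(d.+1, e.+1)], and [across_omega] applies. *)
Lemma bigrassmannianP n (w : 'S_n) : w \in bigrassmannian n ->
  exists a b c, [/\ a < b < c, c <= n & w = omega n a b c].
Proof.
rewrite inE => /andP[/cards1P[d dE] /cards1P[e eE]].
have dn := ltn_ord d; have en := ltn_ord e.
have acr : inversions_across w d.+1 e.+1.
  move=> x y xy wyx; apply/andP; split.
    by have [k] := inversion_descent xy wyx; rewrite dE finset.in_set1 => /eqP ->; lia.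
  have [|k] := @inversion_descent _ (w^-1)%g (w y) (w x) wyx.
    by rewrite !permK.
  by rewrite eE finset.in_set1 => /eqP ->; lia.
have [r1 r2 r3 wE] := across_omega dn en acr.
(* The strict inequalities [a < b < c] come from the descent at [d]: an empty block would make [w]
   the identity. *)
have : d \in descents w by rewrite dE finset.in_set1.
case/mem_descents => l ld; rewrite wE; move: r1 r2 r3 => {wE acr}.
move: (rk _ _ _) => r r1 r2 r3 wld.
exists (d.+1 - r), e.+1, (e.+1 + r); split=> //.
by move: wld; rewrite !omegaE; [rewrite ld; block_swap_lia|lia..].
Qed.

Lemma rk_omega n a b c : a < b < c -> c <= n ->
  rk (omega n a b c) (a + (c - b)) b = c - b.
Proof.
move=> abc cn; rewrite -[RHS](_ : minn (a + (c - b)) n - a = _); last by lia.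
rewrite -sum_interval; apply: eq_bigr => x _.
by rewrite omegaE; [congr nat_of_bool; block_swap_lia|lia|lia].
Qed.

(** The descent of the permutation determines [a + (c - b)], that of its inverse determines [b], and
    the rank at this point is [c - b]. *)
Lemma omega_inj n a b c a' b' c' :
  a < b < c -> c <= n -> a' < b' < c' -> c' <= n ->
  omega n a b c = omega n a' b' c' -> [/\ a = a', b = b' & c = c'].
Proof.
move=> h1 h2 h1' h2' e.
have kn : (a + (c - b)).-1 < n by lia.
have ln : b.-1 < n by lia.
have := descents_omega (Ordinal kn) h1 h2; rewrite e descents_omega //=.
rewrite eqxx => /eqP e1.
have eV : omega n a (a + (c - b)) c = omega n a' (a' + (c' - b')) c'.
  by rewrite -[LHS]omegaV ?e ?omegaV //; lia.
have := @descents_omega n a (a + (c - b)) c (Ordinal ln).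
rewrite eV descents_omega /=; [|lia|lia].
move=> /(_ ltac:(lia) h2) e2.
have := rk_omega h1 h2; rewrite e.
rewrite (_ : a + (c - b) = a' + (c' - b')); last by lia.
rewrite (_ : b = b'); last by lia.
by rewrite rk_omega //; split; lia.
Qed.

(** * Counting the bigrassmannian permutations below a given one *)

Definition triples n : {set triple n} := [set t : triple n | t.1.1 < t.1.2 < t.2].

Definition omega_of n (t : triple n) : 'S_n :=
  omega n t.1.1 t.1.2 t.2.

Lemma omega_of_inj n : {in triples n &, injective (@omega_of n)}.
Proof.
move=> [[a b] c] [[a' b'] c']; rewrite !inE /= => h h' e.
have cn : c <= n by rewrite -ltnS.
have cn' : c' <= n by rewrite -ltnS.
have [? ? ?] := omega_inj h cn h' cn' e.
by congr (_, _, _); apply: val_inj.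
Qed.

Lemma bigrassmannian_imset n :
  bigrassmannian n = [set omega_of t | t in triples n].
Proof.
apply/setP => w; apply/idP/imsetP => [/bigrassmannianP[a [b [c [abc cn ->]]]]|].
  have [an bn cn'] : [/\ a < n.+1, b < n.+1 & c < n.+1] by split; lia.
  by exists (Ordinal an, Ordinal bn, Ordinal cn') => //; rewrite inE.
move=> [[[a b] c]]; rewrite inE /= => abc ->.
by apply: omega_bigrassmannian; rewrite // -ltnS.
Qed.

Lemma rk_le n (w : 'S_n) i j : rk w i j <= i.
Proof.
apply: (@leq_trans (\sum_(x < n) (0 <= x < i))); last first.
  by rewrite sum_interval; lia.
by apply: leq_sum => x _; lia.
Qed.

Lemma rk_leB n (w : 'S_n) i j : rk w i j <= n - j.
Proof.
apply: (@leq_trans (\sum_(x < n) (j <= w x < n))).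
  by apply: leq_sum => x _; have := ltn_ord (w x); lia.
rewrite -[leqRHS](_ : minn n n - j = _); last by lia.
by rewrite -sum_interval [leqRHS](reindex_inj (@perm_inj _ w)).
Qed.

(** At most [j] of the first [i] positions carry a value below [j]. *)
Lemma rk_ge n (w : 'S_n) i j : i <= n -> i - j <= rk w i j.
Proof.
move=> ile; rewrite leq_subLR -[leqLHS](_ : minn i n - 0 = i); last by lia.
apply: (@leq_trans (\sum_x (w x < j) + rk w i j)); last first.
  by rewrite sum_perm_lt; lia.
by rewrite -sum_interval -big_split; apply: leq_sum => x _ /=; lia.
Qed.

(* A triple (a, b, c) is encoded by the point (i, j) = (a + (c - b), b) and the
   rank r = c - b there; a < b < c becomes i - j < r, with truncated subtraction. *)
Lemma beta_rk n (w : 'S_n) :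
  beta w = \sum_(i < n.+1) \sum_(j < n.+1) (rk w i j - (i - j)).
Proof.
have -> : beta w = \sum_(t in triples n | bruhat_le (omega_of t) w) 1.
  rewrite sum1dep_card /beta bigrassmannian_imset.
  rewrite -(card_in_imset (f := @omega_of n)).
    apply: eq_card => p; rewrite !inE; apply/andP/imsetP.
      by case=> /imsetP[t tT ->] le; exists t; rewrite // inE tT.
    case=> t; rewrite inE => /andP[tT le] ->; split=> //.
    by apply/imsetP; exists t.
  by move=> t t'; rewrite !inE => /andP[h _] /andP[h' _];
    apply: omega_of_inj; rewrite inE.
(* [h] decodes [(i, j, r)] into [(a, b, c)] and [h'] encodes; [inord] returns [0] when its argument
   exceeds [n]. *)
pose h (t : triple n) : triple n :=
  (inord (t.1.1 - t.2), t.1.2, inord (t.1.2 + t.2)).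
pose h' (t : triple n) : triple n :=
  (inord (t.1.1 + (t.2 - t.1.2)), t.1.2, inord (t.2 - t.1.2)).
rewrite (reindex_onto h h') /=; last first.
  move=> [[a b] c]; rewrite inE /= => /andP[abc _].
  have := ltn_ord c => cn.
  rewrite /h /h' /= !inordK; [|lia..].
  by congr (_, _, _); apply: val_inj; rewrite /= inordK; lia.
transitivity (\sum_(t : triple n) (t.1.1 - t.1.2 < t.2 <= rk w t.1.1 t.1.2));
    last first.
  rewrite pair_big /=.
  rewrite -(pair_bigA _ (fun (p : 'I_n.+1 * 'I_n.+1) (r : 'I_n.+1) =>
    (p.1 - p.2 < r <= rk w p.1 p.2) : nat)).
  apply: eq_bigr => -[i j] _ /=.
  rewrite (eq_bigr (fun r : 'I_n.+1 =>
    ((i - j).+1 <= r < (rk w i j).+1) : nat)) //.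
  by rewrite sum_interval; have := rk_leB w i j; lia.
rewrite big_mkcond; apply: eq_bigr => -[[i j] r] _.
have [in1 jn rn] : [/\ i < n.+1, j < n.+1 & r < n.+1] by [].
have [ri rB] := (rk_le w i j, rk_leB w i j).
have inordE m : (inord m : 'I_n.+1) = (if m < n.+1 then m else 0) :> nat.
  by rewrite /inord val_insubd.
rewrite inE /h /h' /omega_of /=.
set a := inord (i - r); set c := inord (j + r).
have aE : a = i - r :> nat by rewrite inordE; case: ifP; lia.
have [/andP[ri' jr]|bad] := boolP ((r <= i) && (j + r <= n)).
  have cE : c = j + r :> nat by rewrite inordE; case: ifP; lia.
  have -> : (inord (a + (c - j)), j, inord (c - j)) == (i, j, r).
    apply/eqP; congr (_, _, _); apply: val_inj; rewrite /= inordE; case: ifP; lia.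
  case: ltnP => ab /=; last by lia.
  case: ltnP => bc /=; last by lia.
  rewrite omega_le ?ab ?bc //; last by rewrite cE.
  rewrite (_ : a + (c - j) = i); last by lia.
  rewrite (_ : c - j = r); last by lia.
  by case: ifP; lia.
(* Here the rank bounds exclude [r], so the right side is [0]. On the left, truncation of [i - r] or
   the default [0] for [j + r] breaks either the ordering or the round trip through [h] and [h']. *)
rewrite [RHS](_ : _ = 0); last by lia.
case: ifP => // /andP[/andP[/andP[ab jc] _]].
rewrite !xpair_eqE -!val_eqE /= !inordE.
have cE : c = (if j + r < n.+1 then j + r else 0) :> nat by rewrite inordE.
move: cE; repeat case: ifP; lia.
Qed.

(* The sum over (i, j) of rk w i j is the sum over x of (n - x) (w x + 1);
   i - j is the rank of the identity. *)
Lemma double_beta n (w : 'S_n) :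
  ((beta w)%:Z *+ 2 = \sum_(x < n) ((w x)%:Z - x%:Z) ^+ 2)%R.
Proof.
have sum_rk (s : 'S_n) : \sum_(i < n.+1) \sum_(j < n.+1) rk s i j =
    \sum_(x < n) (n - x) * (s x).+1.
  rewrite pair_big exchange_big /=; apply: eq_bigr => x _.
  rewrite -(pair_bigA _ (fun i j : 'I_n.+1 => ((x < i) && (j <= s x)) : nat)) /=.
  have [xn sxn] := (ltn_ord x, ltn_ord (s x)).
  transitivity (\sum_(i < n.+1) (x.+1 <= i < n.+1) * (s x).+1).
    apply: eq_bigr => i _.
    rewrite -[(s x).+1](_ : minn (s x).+1 n.+1 - 0 = _); last by lia.
    rewrite -sum_interval big_distrr /=; apply: eq_bigr => j _.
    by have := ltn_ord i; lia.
  by rewrite -big_distrl /= sum_interval; congr (_ * _); lia.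
have rk1 i j : i <= n -> rk (1%g : 'S_n) i j = i - j.
  move=> ile; rewrite -[RHS](_ : minn i n - j = _); last by lia.
  by rewrite -sum_interval; apply: eq_bigr => x _; rewrite perm1 andbC.
have E : beta w + \sum_(x < n) (n - x) * x.+1 = \sum_(x < n) (n - x) * (w x).+1.
  rewrite -sum_rk.
  have -> : \sum_(x < n) (n - x) * x.+1 =
      \sum_(x < n) (n - x) * ((1%g : 'S_n) x).+1.
    by apply: eq_bigr => x _; rewrite perm1.
  rewrite -sum_rk beta_rk -big_split; apply: eq_bigr => i _.
  rewrite -big_split; apply: eq_bigr => j _ /=.
  have ile : i <= n by rewrite -ltnS.
  by rewrite rk1 // subnK // rk_ge.
have permZ (f : nat -> int) : (\sum_(x < n) (f (w x) - f x) = 0)%R.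
  rewrite sumrB [X in (_ - X)%R](reindex_inj (@perm_inj _ w)) /=.
  by rewrite subrr.
have {}E : ((beta w)%:Z = \sum_(x < n) (n%:Z - x%:Z) * ((w x)%:Z - x%:Z))%R.
  have := congr1 Posz E; rewrite PoszD => /(canRL (addrK _)) ->.
  rewrite !(big_morph Posz PoszD (erefl _)) -sumrB; apply: eq_bigr => x _.
  by have := ltn_ord x; rewrite !PoszM -(subzn (ltnW (ltn_ord x))); lia.
rewrite E -sumrMnl -[RHS]addr0.
(* Completing the square: twice the product equals the square plus [f (w x) - f x] for
   [f v = 2 n v - v^2], and these differences sum to zero over a permutation. *)
rewrite -[X in (_ + X)%R](permZ (fun v => 2 * n%:Z * v%:Z - v%:Z ^+ 2)%R).
by rewrite -big_split; apply: eq_bigr => x _ /=; ring.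
Qed.

(** In [double_beta], [c - b] entries move by [b - a] and [b - a] entries move by [c - b]; the other
    entries are fixed. *)
Lemma beta_omega n a b c : a < b < c -> c <= n ->
  beta (omega n a b c) * 2 = (b - a) * (c - b) * (c - a).
Proof.
move=> abc cn; apply/eqP; rewrite -eqz_nat; apply/eqP.
rewrite PoszM -[(_ * 2)%R]/(_ * 2%:R)%R mulr_natr double_beta.
have -> : ((b - a) * (c - b) * (c - a) =
   \sum_(x < n) (a <= x < a + (c - b)) * (b - a) ^ 2 +
   \sum_(x < n) (a + (c - b) <= x < c) * (c - b) ^ 2)%N.
  rewrite -!big_distrl /= !sum_interval.
  have [p pE] : exists p, b = a + p by exists (b - a); lia.
  have [q qE] : exists q, c = b + q by exists (c - b); lia.
  rewrite (_ : b - a = p); last by lia.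
  rewrite (_ : c - b = q); last by lia.
  rewrite (_ : c - a = p + q); last by lia.
  rewrite (_ : minn _ _ - a = q); last by lia.
  rewrite (_ : minn _ _ - _ = p); last by lia.
  by ring.
rewrite -big_split (big_morph Posz PoszD (erefl _)); apply: eq_bigr => x _ /=.
rewrite omegaE; [|lia|lia].
rewrite /block_swap -!mulnn; case: ltnP => xa /=.
  rewrite (_ : a + _ <= x = false); last by lia.
  by rewrite subrr expr0n.
case: ltnP => xq /=.
  by rewrite mul1n addn0 PoszD addrAC subrr add0r expr2 PoszM.
case: ltnP => xc /=; last by rewrite subrr expr0n.
have qx : c - b <= x by lia.
by rewrite mul1n add0n -(subzn qx) addrAC subrr sub0r sqrrN expr2 PoszM.
Qed.

(** Hockey-stick summation, over the largest entry and then over the middle one. *)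
Lemma card_triples n : #|triples n| = 'C(n.+1, 3).
Proof.
have -> : #|triples n| = \sum_(t : triple n) (t.1.1 < t.1.2 < t.2).
  by rewrite -sum1_card big_mkcond; apply: eq_bigr => t _; rewrite inE; case: ifP.
have -> : 'C(n.+1, 3) = \sum_(c < n.+1) 'C(c, 2).
  elim: n.+1 => [|m IH]; first by rewrite big_ord0.
  by rewrite big_ord_recr /= -IH binS.
rewrite -(pair_bigA _ (fun (p : 'I_n.+1 * 'I_n.+1) (c : 'I_n.+1) =>
  (p.1 < p.2 < c) : nat)) /=.
rewrite exchange_big /=; apply: eq_bigr => c _.
rewrite -(pair_bigA _ (fun a b : 'I_n.+1 => (a < b < c) : nat)) /=.
rewrite exchange_big /= -bin2_sum big_mkord.
rewrite (big_ord_widen n.+1 (fun i => i)); last by apply: ltnW.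
rewrite [RHS]big_mkcond /=; apply: eq_bigr => b _.
have bn := ltn_ord b; case: ifP => bc.
  rewrite -[RHS](_ : minn b n.+1 - 0 = b); last by lia.
  by rewrite -sum_interval; apply: eq_bigr => a _; rewrite andbT.
by rewrite big1 // => a _; rewrite andbF.
Qed.

End bigrassmannian.

(** * Riemann sums on the unit cube *)

Local Open Scope classical_set_scope.
Local Open Scope ring_scope.

Section vandermonde.
Variable R : realType.
Implicit Types (u v w : R * R * R).

Definition posp (x : R) : R := Num.max x 0.

Lemma posp_ge0 x : 0 <= posp x.
Proof. by rewrite /posp le_max lexx orbT. Qed.

Lemma posp_lip x y : `|posp x - posp y| <= `|x - y|.
Proof.
rewrite /posp; case: (leP x 0) => x0; case: (leP y 0) => y0;
  rewrite ?(max_r x0) ?(max_r y0) ?(max_l (ltW x0)) ?(max_l (ltW y0));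
  rewrite !ler_norml; case: (leP 0 (x - y)) => h;
  rewrite ?(ger0_norm h) ?(ltr0_norm h); lra.
Qed.

(** The positive parts extend the Vandermonde product by zero off the ordered triples while keeping
    it Lipschitz, so no cell crossing a diagonal needs separate treatment. *)
Definition vander v : R :=
  posp (v.1.2 - v.1.1) * posp (v.2 - v.1.1) * posp (v.2 - v.1.2).

Definition unit_cube : set (R * R * R) := `[0, 1] `*` `[0, 1] `*` `[0, 1].

Lemma posp_sub_le1 x y : 0 <= x <= 1 -> 0 <= y <= 1 -> 0 <= posp (x - y) <= 1.
Proof. by move=> hx hy; rewrite posp_ge0 /posp ge_max; lra. Qed.

Lemma unit_cubeP v : unit_cube v <->
  [/\ 0 <= v.1.1 <= 1, 0 <= v.1.2 <= 1 & 0 <= v.2 <= 1].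
Proof.
split; rewrite /unit_cube /= !in_itv /=; first by move=> [[]].
by case.
Qed.

Lemma vander_itv v : unit_cube v -> 0 <= vander v <= 1.
Proof.
move=> /unit_cubeP[h1 h2 h3]; rewrite /vander !mulr_ge0 ?posp_ge0 //=.
have /andP[p1 q1] := posp_sub_le1 h2 h1.
have /andP[p2 q2] := posp_sub_le1 h3 h1.
have /andP[p3 q3] := posp_sub_le1 h3 h2.
by rewrite !mulr_ile1 ?mulr_ge0.
Qed.

(** The splitting [(x - x') y' + x (y - y')] pairs each difference with a factor in the unit
    interval. *)
Lemma mul_lip (x y x' y' : R) : 0 <= x <= 1 -> 0 <= y' <= 1 ->
  `|x * y - x' * y'| <= `|x - x'| + `|y - y'|.
Proof.
move=> /andP[x0 x1] /andP[y0 y1].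
rewrite [X in `|X|](_ : _ = (x - x') * y' + x * (y - y')); last by ring.
apply: le_trans (ler_normD _ _) _.
by rewrite !normrM (ger0_norm x0) (ger0_norm y0) lerD // ?ler_piMr ?ler_piMl.
Qed.

Lemma exp_lip (x y : R) k : 0 <= x <= 1 -> 0 <= y <= 1 ->
  `|x ^+ k - y ^+ k| <= k%:R * `|x - y|.
Proof.
move=> hx hy; elim: k => [|k IH]; first by rewrite !expr0 subrr normr0 mul0r.
rewrite !exprS -natr1 mulrDl mul1r [leRHS]addrC.
have hyk : 0 <= y ^+ k <= 1.
  by case/andP: hy => y0 y1; rewrite exprn_ge0 ?exprn_ile1.
by apply: le_trans (mul_lip _ _ hx hyk) _; rewrite lerD.
Qed.

Lemma vander_lip v w d : unit_cube v -> unit_cube w ->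
  `|v.1.1 - w.1.1| <= d -> `|v.1.2 - w.1.2| <= d -> `|v.2 - w.2| <= d ->
  `|vander v - vander w| <= 6 * d.
Proof.
move=> /unit_cubeP[h1 h2 h3] /unit_cubeP[h1' h2' h3'] d1 d2 d3; rewrite /vander.
have L x y x' y' : `|x - x'| <= d -> `|y - y'| <= d ->
    `|posp (x - y) - posp (x' - y')| <= 2 * d.
  move=> dx dy; apply: le_trans (posp_lip _ _) _.
  rewrite [X in `|X|](_ : _ = (x - x') - (y - y')); last by ring.
  by apply: le_trans (ler_normB _ _) _; lra.
have := L _ _ _ _ d2 d1; have := L _ _ _ _ d3 d1; have := L _ _ _ _ d3 d2.
have q1 := posp_sub_le1 h2 h1; have q2 := posp_sub_le1 h3 h1.
have q12 : 0 <= posp (v.1.2 - v.1.1) * posp (v.2 - v.1.1) <= 1.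
  by case/andP: q1 => ? ?; case/andP: q2 => ? ?; rewrite mulr_ge0 ?mulr_ile1.
have := mul_lip (posp (v.2 - v.1.2)) (posp (w.1.2 - w.1.1) * posp (w.2 - w.1.1))
  q12 (posp_sub_le1 h3' h2').
have := mul_lip (posp (v.2 - v.1.1)) (posp (w.1.2 - w.1.1))
  q1 (posp_sub_le1 h3' h1').
by lra.
Qed.

Lemma measurable_vanderX k : measurable_fun setT (fun v => vander v ^+ k).
Proof.
have m2 : measurable_fun setT (fun v : R * R * R => v.2) by exact: measurable_snd.
have m11 : measurable_fun setT (fun v : R * R * R => v.1.1).
  by apply: (measurableT_comp measurable_fst); exact: measurable_fst.
have m12 : measurable_fun setT (fun v : R * R * R => v.1.2).
  by apply: (measurableT_comp measurable_snd); exact: measurable_fst.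
apply: measurable_funX; apply: measurable_funM; first apply: measurable_funM;
  by apply: measurable_maxr => //; apply: measurable_funB.
Qed.

(** Off the ordered triples some positive part vanishes, and [0 < k] keeps its power zero. *)
Lemma vander_ordered k : (0 < k)%N ->
  (fun v => ((v.1.2 - v.1.1) ^+ k * (v.2 - v.1.1) ^+ k * (v.2 - v.1.2) ^+ k)%:E)
    \_ (@ordered_triples R) = (fun v => (vander v ^+ k)%:E) \_ unit_cube.
Proof.
move=> k0; apply/funext => -[[x y] z]; rewrite !patchE.
case: ifPn; case: ifPn => //.
- rewrite !inE => _ [/= x0 xy yz z1]; rewrite /vander /posp /=.
  by rewrite !max_l ?exprMn //; lra.
- rewrite notin_setE inE => /unit_cubeP h [/= x0 xy yz z1].
  by exfalso; apply: h; split=> /=; lra.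
rewrite inE notin_setE => /unit_cubeP[/= h1 h2 h3] h; congr EFin; apply/esym.
rewrite /vander /posp /=; case: (ltP x y) => xy; last first.
  by rewrite max_r ?mul0r ?expr0n ?gtn_eqF //; lra.
case: (ltP y z) => yz; last first.
  by rewrite [X in _ * X]max_r ?mulr0 ?expr0n ?gtn_eqF //; lra.
by exfalso; apply: h; split=> //=; lra.
Qed.

End vandermonde.

(** * Partition into cells and comparison of integral and sum *)

Section cells.
Variables (R : realType) (n : nat).
Local Notation mu := (@lebesgue_measure R).
Local Notation mu3 := ((mu \x mu) \x mu)%E.
Local Notation N := n.+1.
Implicit Types (a b c : 'I_n.+1) (t : triple n).

(* The last cell is closed, so that the cells partition [[0, 1]]. *)
Definition cell a : set R :=
  [set` Interval (BLeft (a%:R / N%:R)) (BSide (a.+1 < N)%N (a.+1%:R / N%:R))].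

Let N0 : 0 < N%:R :> R. Proof. by rewrite ltr0n. Qed.

Lemma cellP a (x : R) : cell a x ->
  [/\ a%:R / N%:R <= x, x <= a.+1%:R / N%:R &
      (a.+1 < N)%N -> x < a.+1%:R / N%:R].
Proof.
rewrite /cell /= itv_boundlr => /andP[]; rewrite !bnd_simp => ax.
by case: (a.+1 < N)%N; rewrite !bnd_simp => xa; split=> //; exact: ltW.
Qed.

Lemma measurable_cell a : measurable (cell a).
Proof. exact: measurable_itv. Qed.

Lemma lebesgue_measure_cell a : mu (cell a) = (N%:R^-1)%:E.
Proof.
rewrite lebesgue_measure_itv /= lte_fin ltr_pM2r ?invr_gt0 // ltr_nat leqnn.
by rewrite -EFinB -mulrBl -natrB // subSnn mul1r.
Qed.

Lemma cell_inj a b (x : R) : cell a x -> cell b x -> a = b.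
Proof.
wlog ab : a b / (a <= b)%N.
  by move=> H; case/orP: (leq_total a b) => h ? ?; [|apply/esym]; apply: H.
move=> /cellP[_ _ ha] /cellP[hb _ _]; apply: val_inj; apply/eqP.
rewrite /= eqn_leq ab /= leqNgt; apply/negP => lt_ab.
have aN : (a.+1 < N)%N by rewrite (leq_ltn_trans lt_ab).
have := le_lt_trans hb (ha aN).
by rewrite ltr_pM2r ?invr_gt0 // ltr_nat ltnS leqNgt lt_ab.
Qed.

Lemma cell_cover (x : R) : 0 <= x <= 1 -> exists a, cell a x.
Proof.
case/andP => x0 x1.
have /truncn_itv/andP[tx xt] : 0 <= x * N%:R by rewrite mulr_ge0 // ltW.
have [tN|Nt] := ltnP (Num.truncn (x * N%:R)) N.
  exists (Ordinal tN); rewrite /cell /= itv_boundlr.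
  case: (_.+1 < N)%N; rewrite !bnd_simp ler_pdivrMr // tx /=.
    by rewrite ltr_pdivlMr.
  by rewrite ler_pdivlMr // ltW.
(* This case is [x = 1], which lies in the closed last cell. *)
exists ord_max; rewrite /cell /= itv_boundlr ltnn !bnd_simp.
rewrite divff ?gt_eqF // x1 andbT ler_pdivrMr //.
apply: le_trans tx; rewrite ler_nat; exact: leq_trans Nt.
Qed.

Definition box t : set (R * R * R) := cell t.1.1 `*` cell t.1.2 `*` cell t.2.

Lemma measurable_box t : measurable (box t).
Proof. by do 2?apply: measurableX; apply: measurable_cell. Qed.

Lemma measure_box t : mu3 (box t) = (N%:R^-3)%:E.
Proof.
rewrite /box product_measure1E //; last by apply: measurable_cell.
  rewrite /= product_measure1E; try by apply: measurable_cell.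
  by rewrite /= !lebesgue_measure_cell -!EFinM !exprS expr0 mulr1 !invfM mulrA.
by apply: measurableX; apply: measurable_cell.
Qed.

Lemma unit_cube_boxes :
  @unit_cube R = \big[setU/set0]_(t <- index_enum (triple n)) box t.
Proof.
rewrite -bigcup_seq; apply/seteqP; split=> [v /unit_cubeP[h1 h2 h3]|v [t _]].
  have [a ha] := cell_cover h1; have [b hb] := cell_cover h2.
  have [c hc] := cell_cover h3.
  by exists (a, b, c); [rewrite /= mem_index_enum|split].
have itv01 a (x : R) : cell a x -> 0 <= x <= 1.
  move=> /cellP[h1 h2 _]; apply/andP; split.
    by apply: le_trans h1; rewrite divr_ge0.
  by apply: le_trans h2 _; rewrite ler_pdivrMr // mul1r ler_nat.
by move=> [[h1 h2] h3]; apply/unit_cubeP; split; apply: itv01; eassumption.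
Qed.

(** Each of the [N^3] boxes has volume [N^-3] and contributes an error of at most [e] times that
    volume. *)
Lemma integral_unit_cube (f : R * R * R -> R) (g : triple n -> R) (e : R) :
  measurable_fun setT f -> (forall v, 0 <= f v) ->
  (forall t v, box t v -> `|f v - g t| <= e) ->
  `|fine (\int[mu3]_(v in @unit_cube R) (f v)%:E)%E - N%:R^-3 * \sum_t g t| <= e.
Proof.
move=> mf f0 fg.
have mfE D : measurable_fun D (fun v => (f v)%:E).
  by apply/measurable_EFinP; apply: measurable_funTS.
rewrite unit_cube_boxes ge0_integral_bigsetU //=; first last.
- by move=> v _; rewrite lee_fin.
- exact: mfE.
- apply/trivIsetP => -[[a b] c] [[a' b'] c'] _ _ /eqP tt'.
  rewrite -subset0 => -[[x y] z] [[[/= h1 h2] h3] [[/= h1' h2'] h3']]; apply: tt'.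
  by rewrite (cell_inj h1 h1') (cell_inj h2 h2') (cell_inj h3 h3').
- exact: index_enum_uniq.
- exact: measurable_box.
have N3 : 0 <= N%:R^-3 :> R by rewrite invr_ge0 exprn_ge0.
have box_int t : (((g t - e) * N%:R^-3)%:E <= \int[mu3]_(v in box t) (f v)%:E <=
    ((g t + e) * N%:R^-3)%:E)%E.
  have icst r : (r * N%:R^-3)%:E = (\int[mu3]_(v in box t) (cst r%:E v))%E.
    transitivity (r%:E * mu3 (box t))%E; first by rewrite measure_box EFinM.
    by rewrite integral_cst //; exact: measurable_box.
  apply/andP; split.
    (* The comparison lemma concerns nonnegative integrands, so a negative lower constant is
       replaced by [0]. *)
    have [ge0|lt0] := leP 0 (g t - e); last first.
      apply: (@le_trans _ _ 0%E); first by rewrite lee_fin mulr_le0_ge0 // ltW.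
      by apply: integral_ge0 => v _; rewrite lee_fin.
    rewrite icst; apply: ge0_le_integral => //; first exact: measurable_box.
    - exact: mfE.
    by move=> v bv; have := fg t v bv; rewrite lee_fin ler_norml; lra.
  rewrite icst; apply: ge0_le_integral => //; first exact: measurable_box.
  - by move=> v _; rewrite lee_fin.
  - exact: mfE.
  by move=> v bv; have := fg t v bv; rewrite lee_fin ler_norml; lra.
(* The two finite bounds rule out infinite values, so the sum can be taken in the reals. *)
have box_fin t : exists r, (\int[mu3]_(v in box t) (f v)%:E)%E = r%:E /\
    `|r - g t * N%:R^-3| <= e * N%:R^-3.
  have := box_int t; case: (\int[mu3]_(v in box t) (f v)%:E)%E => [r||];
    rewrite ?leye_eq ?leeNy_eq ?andbF //=.
  rewrite !lee_fin mulrBl mulrDl => h; exists r; split=> //.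
  by rewrite ler_norml lerBlDl lerBrDl.
have {box_fin}[r rP] := choice box_fin.
under eq_bigr => t _ do rewrite (rP t).1.
rewrite sumEFin /= mulr_sumr -sumrB; apply: le_trans (ler_norm_sum _ _ _) _.
have -> : e = \sum_(t : triple n) e * N%:R^-3.
  rewrite sumr_const !card_prod card_ord -[LHS]mulr1 -[RHS]mulr_natr -mulrA.
  congr (_ * _).
  by rewrite !natrM -expr2 -exprSr mulVf // expf_neq0 // gt_eqF.
by apply: ler_sum => t _; rewrite [_ * g t]mulrC; have [] := rP t.
Qed.

Definition grid t : R * R * R :=
  ((t.1.1%:R / n%:R, t.1.2%:R / n%:R), t.2%:R / n%:R).

(* Sampling at a / n is legitimate: a / n lies between a / (n + 1) and
   (a + 1) / (n + 1). *)
Lemma Riemann_sum_vander k : (0 < n)%N -> (0 < k)%N ->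
  `|\int[mu3]_(v in @ordered_triples R)
      ((v.1.2 - v.1.1) ^+ k * (v.2 - v.1.1) ^+ k * (v.2 - v.1.2) ^+ k) -
    N%:R^-3 * \sum_t vander (grid t) ^+ k| <= 6 * k%:R / N%:R.
Proof.
move=> n0 k0; rewrite /Rintegral integral_mkcond vander_ordered //.
rewrite -integral_mkcond.
have n0' : 0 < n%:R :> R by rewrite ltr0n.
have posp0 (x : R) : 0 <= posp x by exact: posp_ge0.
apply: integral_unit_cube.
- exact: measurable_vanderX.
- by move=> v; rewrite exprn_ge0 // /vander !mulr_ge0.
move=> t v tv.
have cell01 a (x : R) : cell a x -> 0 <= x <= 1.
  move=> ax.
  have : (@unit_cube R) (x, x, x).
    rewrite unit_cube_boxes -bigcup_seq; exists (a, a, a) => //.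
    by rewrite /= mem_index_enum.
  by move/unit_cubeP => [].
have grid01 a : 0 <= (a%:R / n%:R : R) <= 1.
  by rewrite divr_ge0 //= ler_pdivrMr // mul1r ler_nat -ltnS.
have close a (x : R) : cell a x -> `|x - a%:R / n%:R| <= N%:R^-1.
  move=> /cellP[h1 h2 _].
  have h3 : a%:R / N%:R <= a%:R / n%:R :> R.
    by rewrite ler_wpM2l // lef_pV2 ?posrE // ler_nat.
  have h4 : a%:R / n%:R <= a.+1%:R / N%:R :> R.
    rewrite ler_pdivrMr // mulrAC ler_pdivlMr // -!natrM ler_nat.
    by rewrite mulnS mulSn leq_add2r -ltnS.
  have e : a.+1%:R / N%:R = a%:R / N%:R + N%:R^-1 :> R.
    by rewrite -[a.+1%:R]natr1 mulrDl mul1r.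
  rewrite ler_norml; move: h1 h2 h3 h4; rewrite e.
  by move: (a%:R / N%:R : R) (a%:R / n%:R : R) (N%:R^-1 : R) => A B C; lra.
case: tv => -[v1 v2] v3.
have vc : (@unit_cube R) v by apply/unit_cubeP; split; apply: cell01; eassumption.
have gc : (@unit_cube R) (grid t) by apply/unit_cubeP; split; apply: grid01.
(* The power costs a factor [k]; coordinates within [1 / N] cost [6 / N] through [vander_lip]. *)
apply: le_trans (exp_lip k (vander_itv vc) (vander_itv gc)) _.
rewrite [leRHS](_ : _ = k%:R * (6 * N%:R^-1)); last by ring.
rewrite ler_wpM2l //.
by apply: vander_lip => //; apply: close.
Qed.

End cells.

(** * The moment as a normalised grid sum, and the final estimate *)

Lemma vander_grid_beta (R : realType) n (t : triple n) : t \in triples n ->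
  (beta (omega_of t))%:R / n%:R ^+ 3 = vander (grid R t) / 2 :> R.
Proof.
case: t => [[a b] c]; rewrite inE /= => abc.
have cn : (c <= n)%N by rewrite -ltnS.
have n0 : n%:R != 0 :> R by rewrite pnatr_eq0; lia.
have := congr1 (fun m => m%:R : R) (beta_omega abc cn).
have [ab bc] := andP abc.
rewrite !natrM !natrB ?(ltnW ab) ?(ltnW bc) ?(ltnW (ltn_trans ab bc)) // => e.
have pospE (x y : nat) : (x < y)%N ->
    posp (y%:R / n%:R - x%:R / n%:R) = (y%:R - x%:R) / n%:R :> R.
  move=> xy; rewrite -mulrBl /posp max_l // divr_ge0 // subr_ge0 ler_nat ltnW //.
rewrite /vander /grid /= !pospE //; last by exact: ltn_trans bc.
have bE : (beta (omega n a b c))%:R =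
    (b%:R - a%:R) * (c%:R - b%:R) * (c%:R - a%:R) / 2 :> R.
  by rewrite -e mulfK // pnatr_eq0.
rewrite /omega_of /= bE.
by field.
Qed.

Lemma vander_grid0 (R : realType) n (t : triple n) : t \notin triples n ->
  vander (grid R t) = 0.
Proof.
case: t => [[a b] c]; rewrite inE /= negb_and -!leqNgt /vander /grid /=.
have pospE (x y : nat) : (y <= x)%N -> posp (y%:R / n%:R - x%:R / n%:R) = 0 :> R.
  move=> xy; rewrite -mulrBl /posp max_r // mulr_le0_ge0 ?invr_ge0 //.
  by rewrite subr_le0 ler_nat.
by case/orP => /pospE ->; rewrite ?mulr0 ?mul0r.
Qed.

(** The sum is transported along the injective parametrisation by triples, then extended to the
    whole grid by zero terms. *)
Lemma expectation_beta (R : realType) n k : (0 < k)%N ->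
  uniform_expectation (bigrassmannian n)
    (fun s : 'S_n => ((beta s)%:R / n%:R ^+ 3) ^+ k : R) =
  2%:R ^- k * ((\sum_(t : triple n) vander (grid R t) ^+ k) / #|triples n|%:R).
Proof.
move=> k0; rewrite /uniform_expectation bigrassmannian_imset mulrA.
rewrite (card_in_imset (@omega_of_inj n)) (big_imset _ (@omega_of_inj n)) /=.
congr (_ / _); rewrite [in RHS](bigID (mem (triples n))) /= [X in _ + X]big1.
  rewrite addr0 mulr_sumr; apply: eq_bigr => t tT.
  by rewrite vander_grid_beta // exprMn exprVn mulrC.
by move=> t tN; rewrite vander_grid0 // expr0n gtn_eqF.
Qed.

(** This keeps the normalised sum in [[0, 1]], which controls the change of normalisation from the
    binomial coefficient to [(n + 1)^3 / 6]. *)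
Lemma sum_vander_grid_itv (R : realType) n k : (0 < n)%N -> (0 < k)%N ->
  0 <= \sum_(t : triple n) vander (grid R t) ^+ k <= #|triples n|%:R.
Proof.
move=> n0 k0.
have grid1 (t : triple n) : 0 <= vander (grid R t) <= 1.
  apply: vander_itv; apply/unit_cubeP.
  have g (a : 'I_n.+1) : 0 <= (a%:R / n%:R : R) <= 1.
    by rewrite divr_ge0 //= ler_pdivrMr ?ltr0n // mul1r ler_nat -ltnS.
  by split; apply: g.
rewrite sumr_ge0 => [|t _]; last by rewrite exprn_ge0 //; case/andP: (grid1 t).
rewrite -sum1_card natr_sum (bigID (mem (triples n))) /= [X in _ + X]big1.
  rewrite addr0; apply: ler_sum => t _; case/andP: (grid1 t) => *.
  by rewrite exprn_ile1.
by move=> t tN; rewrite vander_grid0 // expr0n gtn_eqF.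
Qed.

Lemma card_triplesE (R : realType) n :
  #|triples n|%:R * 6 = (n%:R + 1) * n%:R * (n%:R - 1) :> R.
Proof.
rewrite card_triples; case: n => [|n].
  by rewrite bin_small // mul0r mulr0 mul0r.
have := congr1 (fun m => m%:R : R) (bin_ffact n.+2 3).
rewrite natrM !ffactSS ffactn1 !natrM => ->.
by rewrite -[n.+2%:R]natr1 -[n.+1%:R]natr1; ring.
Qed.

Theorem theorem4p8 (R : realType) (k : nat) (hk : (1 <= k)%N) :
  (fun n : nat => uniform_expectation (bigrassmannian n)
     (fun s : 'S_n => ((beta s)%:R / n%:R ^+ 3) ^+ k : R))
  = (fun _ : nat => 6%:R / 2%:R ^+ k *
       \int[((@lebesgue_measure R \x @lebesgue_measure R)
               \x @lebesgue_measure R)%E]_(v in @ordered_triples R)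
         ((v.1.2 - v.1.1) ^+ k * (v.2 - v.1.1) ^+ k * (v.2 - v.1.2) ^+ k) : R)
  +O_ \oo (fun n : nat => k%:R / (2%:R ^+ k * n%:R) : R).
Proof.
(* Starting at [n = 2] makes the number of triples positive. *)
apply/eqaddOP; near=> C; exists 2%N => // n /= n2.
rewrite !fctE expectation_beta //.
have n0 : (0 < n)%N by lia.
have := @Riemann_sum_vander R n k n0 hk.
have := @sum_vander_grid_itv R n k n0 hk.
move: (\int[_]_(_ in _) _) (\sum_t _) => I S S_itv IS.
have TE := card_triplesE R n.
have nR : 1 < n%:R :> R by rewrite ltr1n.
have T0 : 0 < #|triples n|%:R :> R by nra.
move: TE T0 S_itv; move: (#|triples n|%:R : R) => T TE T0 /andP[S0 ST].
have N0 : 0 < n.+1%:R :> R by rewrite ltr0n.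
have {}IS : `|n.+1%:R ^- 3 * S - I| <= 6 * k%:R / n.+1%:R by rewrite distrC.
(* The relative error is [1 - n (n - 1) / (n + 1)^2 = (3 n + 1) / (n + 1)^2], below
   [3 / (n + 1)]. *)
have ratio : `|S / T - 6 * (n.+1%:R ^- 3 * S)| <= 3 / n.+1%:R.
  have -> : S / T - 6 * (n.+1%:R ^- 3 * S) = S / T * (1 - T * 6 / n.+1%:R ^+ 3).
    by field; rewrite !gt_eqF.
  rewrite normrM -[leRHS]mul1r ler_pM //.
    by rewrite ger0_norm ?divr_ge0 ?(ltW T0) // ler_pdivrMr // mul1r.
  rewrite TE [X in `|X|](_ : _ = (3 * n%:R + 1) / n.+1%:R ^+ 2); last first.
    by rewrite -[n.+1%:R]natr1; field; rewrite natr1 gt_eqF.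
  have num0 : 0 <= 3 * n%:R + 1 :> R by rewrite addr_ge0 ?mulr_ge0.
  rewrite ger0_norm; last by rewrite divr_ge0 // exprn_ge0 // ltW.
  rewrite expr2 invfM mulrA ler_pM2r ?invr_gt0 // ler_pdivrMr //.
  by rewrite -[n.+1%:R]natr1; lra.
have k1 : 1 <= k%:R :> R by rewrite ler1n.
have p2 : 0 < 2 ^+ k :> R by rewrite exprn_gt0.
have rhs0 : 0 <= k%:R / (2 ^+ k * n%:R) :> R.
  by rewrite divr_ge0 // mulr_ge0 // ltW.
(* The constant is [39 = 3 + 6 * 6]: [3] from the normalisation, using [1 <= k], and [6] times the
   Riemann sum error [6 k / (n + 1)]. *)
rewrite (ger0_norm rhs0); apply: (@le_trans _ _ (39 * (k%:R / (2 ^+ k * n%:R)))).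
  rewrite (_ : _ - _ = 2 ^- k * (S / T - 6 * (n.+1%:R ^- 3 * S) +
      6 * (n.+1%:R ^- 3 * S - I))); last by ring.
  rewrite normrM ger0_norm ?invr_ge0 ?(ltW p2) //.
  rewrite [leRHS](_ : _ = 2 ^- k * (39 * k%:R / n%:R)); last first.
    by field; rewrite !gt_eqF // ltr0n.
  rewrite ler_wpM2l ?invr_ge0 ?(ltW p2) //.
  apply: le_trans (ler_normD _ _) _; rewrite normrM (ger0_norm (_ : 0 <= 6)) //.
  have nN : n.+1%:R^-1 <= n%:R^-1 :> R.
    by rewrite lef_pV2 ?posrE ?ltr0n // ler_nat.
  have V0 : 0 < n.+1%:R^-1 :> R by rewrite invr_gt0.
  move: ratio IS; move: (`|_|) (`|_|) (n.+1%:R^-1 : R) (n%:R^-1 : R) nN V0.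
  by move=> A B u v uv u0; nra.
by rewrite ler_wpM2r.
Unshelve. all: by end_near.
Qed.
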